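(* Let $s$ be a positive integer and let $g:\mathbb{Z}_{\ge0}\to\mathbb{Z}_{\ge0}$ be nondecreasing such that $G_g(\{y,z\})=(y\oplus(z+s))-s$ for all $y,z\in\mathbb{Z}_{\ge0}$ with $y\le g(z)$. Define $g_{-s}(z)=g(z-s)$ for $z\ge s$ and $g_{-s}(z)=g(0)$ for $0\le z<s$. Then $G_{g_{-s}}(\{y,z\})=y\oplus z$ for all $y,z\in\mathbb{Z}_{\ge0}$ with $y\le g_{-s}(z)$.
   Context: $\oplus$ denotes nim-sum (bitwise XOR). For a nondecreasing $f:\mathbb{Z}_{\ge0}\to\mathbb{Z}_{\ge0}$, positions of the chocolate bar game $CB(f,y,z)$ are pairs $\{y,z\}$ with $y\le f(z)$ (bar with $z+1$ columns, column 0 bitter, column $i$ of height $\min(f(i),y)+1$). Moves: $move_f(\{y,z\})=\{\{v,z\}:v<y\}\cup\{\{\min(y,f(w)),w\}:w<z\}$. Grundy number: $G_f(\{y,z\})=\mathrm{mex}\{G_f(p):p\in move_f(\{y,z\})\}$, mex being the least nonnegative integer not in the set. *)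

(* Defs.v *)
From Stdlib Require Import Arith List Lia ZArith.

(* The least natural number missing from l is at most [length l]. *)
Definition mex (l : list nat) : nat :=
  hd 0 (filter (fun n => if in_dec Nat.eq_dec n l then false else true)
               (seq 0 (S (length l)))).

Lemma mex_spec (l : list nat) :
  ~ In (mex l) l /\ (forall m, m < mex l -> In m l).
Proof.
pose (P := fun n => if in_dec Nat.eq_dec n l then false else true).
assert (aux : forall k a,
  (exists n, a <= n < a + k /\ ~ In n l) ->
  let r := hd 0 (filter P (seq a k)) in
  ~ In r l /\ (forall m, a <= m -> m < r -> In m l)).
{ induction k as [|k IH]; intros a [n [Hn Hl]]; [lia|].
  cbn [seq filter].
  assert (HP : if P a then ~ In a l else In a l)
    by (unfold P; destruct (in_dec Nat.eq_dec a l); assumption).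
  destruct (P a); cbn [hd].
  - split; [assumption|]. intros m Hm Hr. lia.
  - destruct (IH (S a)) as [H1 H2].
    { exists n. split; [|assumption].
      assert (n <> a) by congruence. lia. }
    split; [exact H1|]. intros m Hm Hr.
    destruct (Nat.eq_dec m a) as [->|]; [assumption|]. apply H2; [lia|exact Hr]. }
destruct (aux (S (length l)) 0) as [H1 H2].
- destruct (Exists_dec (fun n => ~ In n l) (seq 0 (S (length l)))) as [E|E].
  { intros x. destruct (in_dec Nat.eq_dec x l); [right|left]; tauto. }
  + apply Exists_exists in E. destruct E as [n [Hn Hl]].
    apply in_seq in Hn. exists n. split; [lia|assumption].
  + exfalso.
    assert (Hle : length (seq 0 (S (length l))) <= length l).
    { apply NoDup_incl_length; [apply seq_NoDup|]. intros x Hx.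
      destruct (in_dec Nat.eq_dec x l) as [Hi|Hi]; [assumption|].
      exfalso. apply E, Exists_exists. now exists x. }
    rewrite length_seq in Hle. lia.
- split; [exact H1|]. intros m Hm. apply H2; [lia|exact Hm].
Qed.

Definition nondecreasing (f : nat -> nat) : Prop :=
  forall a b, a <= b -> f a <= f b.

(* The pair (y, z) is a position of CB(f, y, z) when y <= f z; options of
   positions are again positions, so the functions below may be total on
   pairs. *)
Definition moves (f : nat -> nat) (p : nat * nat) : list (nat * nat) :=
  let (y, z) := p in
  map (fun v => (v, z)) (seq 0 y)
  ++ map (fun w => (Nat.min y (f w), w)) (seq 0 z).

(* Every move decreases y + z, so y + z + 1 is enough fuel;
   [grundy_eq] is the defining recursion. *)
Fixpoint grundy_fuel (n : nat) (f : nat -> nat) (p : nat * nat) : nat :=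
  match n with
  | 0 => 0
  | S n' => mex (map (grundy_fuel n' f) (moves f p))
  end.

Definition grundy (f : nat -> nat) (p : nat * nat) : nat :=
  grundy_fuel (S (fst p + snd p)) f p.

Lemma moves_spec (f : nat -> nat) (y z : nat) (q : nat * nat) :
  In q (moves f (y, z)) <->
  (exists v, v < y /\ q = (v, z)) \/
  (exists w, w < z /\ q = (Nat.min y (f w), w)).
Proof.
unfold moves. rewrite in_app_iff, !in_map_iff.
split; (intros [[v [H1 H2]]|[w [H1 H2]]]; [left; exists v|right; exists w]);
  rewrite in_seq in *; (split; [lia || congruence|lia || congruence]).
Qed.

Lemma moves_position (f : nat -> nat) (y z y' z' : nat) :
  y <= f z -> In (y', z') (moves f (y, z)) -> y' <= f z'.
Proof.
intros H Hq. apply moves_spec in Hq.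
destruct Hq as [[v [Hv E]]|[w [Hw E]]]; inversion E; subst; lia.
Qed.

Lemma moves_decrease (f : nat -> nat) (p q : nat * nat) :
  In q (moves f p) -> fst q + snd q < fst p + snd p.
Proof.
destruct p as [y z]. intros Hq. apply moves_spec in Hq.
destruct Hq as [[v [Hv ->]]|[w [Hw ->]]]; cbn; lia.
Qed.

Lemma grundy_fuel_enough (f : nat -> nat) (n m : nat) (p : nat * nat) :
  fst p + snd p < n -> fst p + snd p < m ->
  grundy_fuel n f p = grundy_fuel m f p.
Proof.
revert m p. induction n as [|n IH]; intros [|m] p Hn Hm; try lia.
cbn [grundy_fuel]. f_equal. apply map_ext_in. intros q Hq.
apply moves_decrease in Hq. apply IH; lia.
Qed.

Lemma grundy_eq (f : nat -> nat) (p : nat * nat) :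
  grundy f p = mex (map (grundy f) (moves f p)).
Proof.
unfold grundy at 1. cbn [grundy_fuel]. f_equal. apply map_ext_in.
intros q Hq. apply moves_decrease in Hq. apply grundy_fuel_enough; lia.
Qed.

(* g_{-s}: g translated right by s, extended by g 0 below s. *)
Definition shifted (g : nat -> nat) (s : nat) (z : nat) : nat :=
  if z <? s then g 0 else g (z - s).

(* Main.v *)
Require Import Defs.
From Stdlib Require Import Arith List Lia ZArith.

(** Since [g 0 <= g z], nonnegativity of the Grundy numbers of [g] says that
    [c xor (z + s) >= s] for all [c <= g 0] and all [z]; as [xor c] is an
    involution, it therefore permutes [0, s).  Hence the options [(c, w)] with
    [w < s] of a position [(y, z + s)] of the shifted bar contribute exactly
    the values [0, ..., s - 1].  The other options are those of [(y, z)] in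
    the original bar, with values raised by [s].  Below column [s] the shifted
    bar is a rectangle, that is, two-heap Nim. *)

Lemma mex_unique (l : list nat) (n : nat) :
  ~ In n l -> (forall m, m < n -> In m l) -> mex l = n.
Proof.
intros Hn Hlt. destruct (mex_spec l) as [Hm Hmlt].
destruct (Nat.lt_trichotomy (mex l) n) as [H|[H|H]].
- now destruct (Hm (Hlt _ H)).
- assumption.
- now destruct (Hn (Hmlt _ H)).
Qed.

Lemma grundy_unique (f : nat -> nat) (p : nat * nat) (n : nat) :
  (forall q, In q (moves f p) -> grundy f q <> n) ->
  (forall m, m < n -> exists q, In q (moves f p) /\ grundy f q = m) ->
  grundy f p = n.
Proof.
intros Hne Hlt. rewrite grundy_eq. apply mex_unique.
- intros Hin. apply in_map_iff in Hin. destruct Hin as [q [Hq Hin]].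
  exact (Hne q Hin Hq).
- intros m Hm. apply in_map_iff. destruct (Hlt m Hm) as [q [Hin Hq]].
  now exists q.
Qed.

Lemma grundy_option_neq (f : nat -> nat) (p q : nat * nat) :
  In q (moves f p) -> grundy f q <> grundy f p.
Proof.
intros Hq E. rewrite (grundy_eq f p) in E.
destruct (mex_spec (map (grundy f) (moves f p))) as [H _].
apply H. rewrite <- E. now apply in_map.
Qed.

Lemma grundy_option_lt (f : nat -> nat) (p : nat * nat) (m : nat) :
  m < grundy f p -> exists q, In q (moves f p) /\ grundy f q = m.
Proof.
intros Hm. rewrite grundy_eq in Hm.
destruct (mex_spec (map (grundy f) (moves f p))) as [_ H].
apply H, in_map_iff in Hm. destruct Hm as [q [Hq Hin]]. now exists q.
Qed.

Lemma lxor_cancel_l (a b : nat) : Nat.lxor a (Nat.lxor a b) = b.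
Proof. now rewrite <- Nat.lxor_assoc, Nat.lxor_nilpotent, Nat.lxor_0_l. Qed.

Lemma lxor_cancel_r (a b : nat) : Nat.lxor (Nat.lxor a b) b = a.
Proof. now rewrite Nat.lxor_assoc, Nat.lxor_nilpotent, Nat.lxor_0_r. Qed.

Lemma lxor_inj_l (a b c : nat) : Nat.lxor a b = Nat.lxor a c -> b = c.
Proof.
intros H. now rewrite <- (lxor_cancel_l a b), H, lxor_cancel_l.
Qed.

Lemma lxor_inj_r (a b c : nat) : Nat.lxor a c = Nat.lxor b c -> a = b.
Proof.
intros H. now rewrite <- (lxor_cancel_r a c), H, lxor_cancel_r.
Qed.

Lemma lxor_1_odd_lt (q : nat) : Nat.odd q = true -> Nat.lxor q 1 < q.
Proof.
intros H. apply Nat.odd_spec in H. destruct H as [m ->].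
(* Adding 1 to an even number produces no carry, so it is the same as xor with 1. *)
assert (E : 2 * m + 1 = Nat.lxor (2 * m) 1).
{ apply Nat.add_nocarry_lxor. change 1 with (Nat.ones 1).
  rewrite Nat.land_ones, Nat.mul_comm. apply Nat.Div0.mod_mul. }
rewrite E at 1. rewrite lxor_cancel_r. lia.
Qed.

(** Dividing by [2 ^ Nat.log2 x] turns [x] into 1 and [a] into an odd number, which xor with 1
    decreases; as division is monotone, a strict drop of the quotient forces a strict drop of the
    number. *)
Lemma lxor_lt_of_top_bit (a x : nat) :
  x <> 0 -> Nat.testbit a (Nat.log2 x) = true -> Nat.lxor a x < a.
Proof.
intros Hx Ha. set (k := Nat.log2 x) in *.
destruct (Nat.log2_spec x ltac:(lia)) as [H1 H2]. fold k in H1, H2.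
assert (Hx1 : Nat.shiftr x k = 1).
{ rewrite Nat.shiftr_div_pow2. symmetry.
  apply (Nat.div_unique _ _ _ (x - 2 ^ k)).
  - rewrite Nat.pow_succ_r' in H2. lia.
  - lia. }
assert (H : Nat.shiftr (Nat.lxor a x) k < Nat.shiftr a k).
{ rewrite Nat.shiftr_lxor, Hx1. apply lxor_1_odd_lt.
  now rewrite <- Nat.bit0_odd, Nat.shiftr_spec by lia. }
rewrite !Nat.shiftr_div_pow2 in H.
apply Nat.nle_gt. intros Hle.
apply (Nat.Div0.div_le_mono _ _ (2 ^ k)) in Hle. lia.
Qed.

(* The combinatorial core of Bouton's theorem for two heaps. *)
Lemma lt_lxor_cases (m y z : nat) :
  m < Nat.lxor y z -> Nat.lxor m z < y \/ Nat.lxor y m < z.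
Proof.
(* [x] is the discrepancy between [m] and the Nim value; its top bit is set in an odd number of [m],
   [y], [z]. A heap that has this bit shrinks under xor with [x]; if neither heap has it, [m] does,
   and [Nat.lxor y z < m] contradicts [Hm]. *)
intros Hm. set (x := Nat.lxor m (Nat.lxor y z)).
assert (Hx : x <> 0).
{ intros E. apply Nat.lxor_eq in E. lia. }
assert (Em : Nat.lxor m x = Nat.lxor y z) by apply lxor_cancel_l.
assert (Ey : Nat.lxor y x = Nat.lxor m z).
{ unfold x. rewrite (Nat.lxor_comm m), Nat.lxor_assoc, lxor_cancel_l.
  apply Nat.lxor_comm. }
assert (Ez : Nat.lxor z x = Nat.lxor y m).
{ unfold x. rewrite (Nat.lxor_comm y), (Nat.lxor_comm m), Nat.lxor_assoc.
  apply lxor_cancel_l. }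
assert (Hbit : Nat.testbit x (Nat.log2 x) = true) by now apply Nat.bit_log2.
unfold x at 1 in Hbit. rewrite !Nat.lxor_spec in Hbit.
destruct (Nat.testbit y (Nat.log2 x)) eqn:By.
{ left. rewrite <- Ey. now apply lxor_lt_of_top_bit. }
destruct (Nat.testbit z (Nat.log2 x)) eqn:Bz.
{ right. rewrite <- Ez. now apply lxor_lt_of_top_bit. }
destruct (Nat.testbit m (Nat.log2 x)) eqn:Bm; [|discriminate].
apply (lxor_lt_of_top_bit m x Hx) in Bm. lia.
Qed.

(** The bound [y <= f 0] keeps [Nat.min y (f w)] equal to [y], so cutting columns never lowers the
    bar and the two coordinates are independent heaps. *)
Lemma grundy_rectangle (f : nat -> nat) (n : nat) :
  (forall z, z <= n -> f z = f 0) ->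
  forall y z, z <= n -> y <= f 0 -> grundy f (y, z) = Nat.lxor y z.
Proof.
intros Hf y z.
remember (y + z) as k eqn:Ek. revert y z Ek.
induction k as [k IH] using lt_wf_ind. intros y z Ek Hz Hy.
apply grundy_unique.
- intros q Hq. apply moves_spec in Hq.
  destruct Hq as [[v [Hv ->]]|[w [Hw ->]]].
  + rewrite (IH (v + z)) by lia. intros E. apply lxor_inj_r in E. lia.
  + rewrite Hf, Nat.min_l by lia.
    rewrite (IH (y + w)) by lia. intros E. apply lxor_inj_l in E. lia.
- intros m Hm. destruct (lt_lxor_cases m y z Hm) as [H|H].
  + exists (Nat.lxor m z, z). split.
    * apply moves_spec. left. now exists (Nat.lxor m z).
    * rewrite (IH (Nat.lxor m z + z)) by lia. apply lxor_cancel_r.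
  + exists (y, Nat.lxor y m). split.
    * apply moves_spec. right. exists (Nat.lxor y m).
      rewrite Hf, Nat.min_l by lia. now split.
    * rewrite (IH (y + Nat.lxor y m)) by lia. apply lxor_cancel_l.
Qed.

Lemma shifted_lt (g : nat -> nat) (s z : nat) : z < s -> shifted g s z = g 0.
Proof. intros H. unfold shifted. now rewrite (proj2 (Nat.ltb_lt z s) H). Qed.

Lemma shifted_add (g : nat -> nat) (s z : nat) : shifted g s (z + s) = g z.
Proof.
unfold shifted. destruct (Nat.ltb_spec (z + s) s); [lia|].
now rewrite Nat.add_sub.
Qed.

Lemma moves_shifted (g : nat -> nat) (s y z y' z' : nat) :
  In (y', z' + s) (moves (shifted g s) (y, z + s)) <->
  In (y', z') (moves g (y, z)).
Proof.
rewrite !moves_spec. split.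
- intros [[v [Hv E]]|[w [Hw E]]]; injection E as -> Ez.
  + left. exists v. split; [assumption|f_equal; lia].
  + subst w. right. exists z'. rewrite shifted_add. split; [lia|reflexivity].
- intros [[v [Hv E]]|[w [Hw E]]]; injection E as -> ->.
  + left. now exists v.
  + right. exists (w + s). rewrite shifted_add. split; [lia|reflexivity].
Qed.

Theorem mainTheorem5 (s : nat) (hs : 0 < s) (g : nat -> nat)
  (hg : nondecreasing g)
  (hG : forall y z : nat, y <= g z ->
     Z.of_nat (grundy g (y, z))
     = (Z.of_nat (Nat.lxor y (z + s)) - Z.of_nat s)%Z) :
  forall y z : nat, y <= shifted g s z ->
    grundy (shifted g s) (y, z) = Nat.lxor y z.
Proof.
assert (HG : forall y z, y <= g z -> Nat.lxor y (z + s) = grundy g (y, z) + s).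
{ intros y z H. apply hG in H. lia. }
assert (Hperm : forall c w, c <= g 0 -> w < s -> Nat.lxor c w < s).
{ intros c w Hc Hw. apply Nat.nle_gt. intros H.
  (* If [Nat.lxor c w] were at least [s], it would be [z + s] for some column [z] of [g], and [HG]
     there would give [w >= s]. *)
  pose proof (HG c (Nat.lxor c w - s)) as E.
  rewrite Nat.sub_add, lxor_cancel_l in E by assumption.
  pose proof (hg 0 (Nat.lxor c w - s)). lia. }
assert (Hlow : forall y z, z < s -> y <= g 0 ->
          grundy (shifted g s) (y, z) = Nat.lxor y z).
{ intros y z Hz Hy. apply (grundy_rectangle _ z); [|lia|].
  - intros w Hw. now rewrite !shifted_lt by lia.
  - now rewrite shifted_lt. }
intros y z.
remember (y + z) as k eqn:Ek. revert y z Ek.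
induction k as [k IH] using lt_wf_ind. intros y z Ek Hy.
destruct (Nat.lt_ge_cases z s) as [Hz|Hz].
{ rewrite shifted_lt in Hy by assumption. now apply Hlow. }
replace z with (z - s + s) in * by lia.
set (z0 := z - s) in *. clearbody z0. clear z Hz.
rewrite shifted_add in Hy.
assert (Hopt : forall y' z', In (y', z') (moves g (y, z0)) ->
          grundy (shifted g s) (y', z' + s) = grundy g (y', z') + s).
{ intros y' z' Hq. pose proof (moves_decrease _ _ _ Hq) as Hd. cbn in Hd.
  apply (moves_position _ _ _ _ _ Hy) in Hq.
  rewrite (IH (y' + (z' + s))), HG by (rewrite ?shifted_add; lia).
  reflexivity. }
(* [HG] turns the target value into the Grundy number in the original bar raised by [s]. *)
rewrite HG by assumption. apply grundy_unique.
- intros [y' z'] Hq. destruct (Nat.lt_ge_cases z' s) as [Hz|Hz].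
  (* Options left of column [s] have values below [s], too small to equal the target. *)
  + pose proof (moves_position (shifted g s) y (z0 + s) y' z') as Hp.
    rewrite shifted_add, (shifted_lt _ _ z') in Hp by assumption.
    specialize (Hp Hy Hq).
    rewrite Hlow by assumption. pose proof (Hperm y' z' Hp Hz). lia.
  + replace z' with (z' - s + s) in * by lia.
    apply moves_shifted in Hq. rewrite Hopt by assumption.
    apply grundy_option_neq in Hq. lia.
- intros m Hm. destruct (Nat.lt_ge_cases m s) as [Hms|Hms].
  (* Every cut to a column below [s] leaves height [c]; the cut to column [Nat.lxor c m], which
     [Hperm] places below [s], has value [m]. *)
  + set (c := Nat.min y (g 0)).
    assert (Hc : c <= g 0) by (unfold c; lia).
    pose proof (Hperm c m Hc Hms) as Hw.
    exists (c, Nat.lxor c m). split.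
    * apply moves_spec. right. exists (Nat.lxor c m).
      rewrite shifted_lt by assumption. split; [lia|reflexivity].
    * rewrite Hlow by assumption. apply lxor_cancel_l.
  (* Values from [s] upwards come from the original options with value [m - s], moved right by
     [s]. *)
  + destruct (grundy_option_lt g (y, z0) (m - s)) as [[y' z'] [Hq E]]; [lia|].
    exists (y', z' + s). split.
    * now apply moves_shifted.
    * rewrite Hopt by assumption. lia.
Qed.
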